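(* Let $p>2$ be a prime and let $H_p=\langle x,y : x^{p^2}=1,\ y^{p}=1,\ [x,y]=x^p\rangle$ be the non-abelian group of order $p^3$ and exponent $p^2$. Then $T(H_p)$ is a cyclic group of order $p-1$.
   Context: For a group $G$, $S(G)$ is the group of permutations of the set $G$. Let $\rho:G\to S(G)$, $\rho(g):h\mapsto hg$, be the right regular representation. Put $\operatorname{Hol}(G)=N_{S(G)}(\rho(G))=\operatorname{Aut}(G)\rho(G)$, $\operatorname{NHol}(G)=N_{S(G)}(\operatorname{Hol}(G))$ and $T(G)=\operatorname{NHol}(G)/\operatorname{Hol}(G)$. Commutators are $[a,b]=a^{-1}b^{-1}ab$. *)

(* Defs.v *)
From mathcomp Require Import all_boot all_fingroup all_solvable.

Set Implicit Arguments.
Unset Strict Implicit.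
Unset Printing Implicit Defensive.

Local Open Scope group_scope.

(* The abstract group G is the whole type gT, so S(G) is {perm gT}.  Products
   of permutations are read left to right: (s * t) h = t (s h). *)

Definition right_regular (gT : finGroupType) : {group {perm gT}} :=
  (actperm 'R @* [set: gT])%G.

Definition Hol (gT : finGroupType) : {group {perm gT}} :=
  'N(right_regular gT)%G.

Definition NHol (gT : finGroupType) : {group {perm gT}} := 'N(Hol gT)%G.

Definition T (gT : finGroupType) : {group coset_of (Hol gT)} :=
  (NHol gT / Hol gT)%G.

Lemma mem_right_regular (gT : finGroupType) (s : {perm gT}) :
  reflect (exists g : gT, forall h : gT, s h = h * g) (s \in right_regular gT).
Proof.
apply: (iffP idP) => [/morphimP[g _ _ ->] | [g def_s]].
  by exists g => h; rewrite actpermE.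
suffices ->: s = actperm 'R g by rewrite mem_morphim ?inE.
by apply/permP=> h; rewrite actpermE def_s.
Qed.

(* The presentation of H_p is realised by the library's modular group of order
   p ^ 3, which is the non-abelian group of that order and exponent p ^ 2. *)
Lemma modular_group_pres (p : nat) :
    prime p -> 2 < p ->
  [set: 'Mod_(p ^ 3)]
    \isog Grp (x : y : x ^+ (p ^ 2), y ^+ p, [~ x, y] = x ^+ p).
Proof.
move=> p_pr p_gt2 rT H; rewrite (@Grp_modular_group p 3 p_pr isT rT H) /=.
apply: eq_existsb => -[x y] /=; rewrite !xpair_eqE /= !expn1.
by rewrite commgEl expgS (can2_eq (mulKVg x) (mulKg x)).
Qed.

(* Main.v *)
Require Import Defs.
From mathcomp Require Import all_boot all_fingroup all_solvable all_algebra zify.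

Set Implicit Arguments.
Unset Strict Implicit.

Local Open Scope group_scope.

(** Conjugation by [theta] in NHol(G) turns the right regular representation
    rho(G) into a subgroup N of Hol(G) that is again regular, isomorphic to G and
    normal in Hol(G); the class of [theta] modulo Hol(G) is determined by N.  So
    the order of T(G) is the number of subgroups N that arise in this way, and
    the proof bounds this number from above and exhibits a large cyclic subgroup
    of T(G).

    Upper bound.  Let N be such a subgroup of Hol(H_p), and [t] the element of N
    that sends 1 to [x]; it has the form [h |-> a h * x] with [a] an automorphism.
    An automorphism [b] conjugates [t] to the element of N that sends 1 to [b x].
    Taking for [b] conjugation by [x], and then an automorphism with
    [b x = x ^ (p e - 1)] for a suitable [e], forces [a x = x]
    (conj_regular_linear_part_fix_x); then [a] has to be conjugation by a power
    [x ^ k], where only [k] modulo [p] matters (conj_regular_inn_rho).  The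
    automorphism [x |-> x y] conjugates [t] to a second element of N, and the two
    generate N (conj_regular_generators).  Thus N is determined by [k].  The two
    generators commute when [2 k + 1 = 0] modulo [p], which is impossible because
    N is not abelian.  This leaves [p - 1] possibilities (card_T_le).

    Lower bound.  In a group of class two the power map [g |-> g ^ d], with [d]
    odd and prime to the order, lies in NHol (power_NHol).  It is an
    automorphism of H_p only if [d = 1] modulo [p] (morph_expgn_mod).  Hence
    for [d] a primitive root modulo [p] its class in T(H_p) has order at least
    [p - 1], so that this class generates T(H_p).

    The automorphisms used in the upper bound come from the presentation
    (presentation_automorphism). *)

(** * Bijective endomorphisms as permutations *)

Section MorphPerm.
Variables (gT : finGroupType) (s : {perm gT}).
Hypothesis sM : {morph s : g h / g * h}.

Lemma morph_perm1 : s 1 = 1.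
Proof. by apply: (mulgI (s 1)); rewrite -sM !mulg1. Qed.

Lemma morph_permX g n : s (g ^+ n) = s g ^+ n.
Proof.
by elim: n => [|n IHn]; rewrite ?morph_perm1 // !expgS sM IHn.
Qed.

Lemma morph_permV g : s g^-1 = (s g)^-1.
Proof. by apply: (mulgI (s g)); rewrite -sM !mulgV morph_perm1. Qed.

Lemma morph_permR g h : s [~ g, h] = [~ s g, s h].
Proof. by rewrite /commg /conjg !sM !morph_permV. Qed.

End MorphPerm.

(** * The holomorph and its normalizer *)

Section Holomorph.

Variable gT : finGroupType.
Implicit Types (g h x y : gT) (s t u theta : {perm gT}).

Definition rho g : {perm gT} := actperm 'R g.
Definition inn g : {perm gT} := actperm 'J g.

Lemma rhoE g h : rho g h = h * g. Proof. by rewrite actpermE. Qed.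
Lemma innE g h : inn g h = h ^ g. Proof. by rewrite actpermE. Qed.

Lemma mem_rho g : rho g \in right_regular gT.
Proof. by apply/mem_right_regular; exists g => h; rewrite rhoE. Qed.

Lemma right_regularP s :
  reflect (exists g, s = rho g) (s \in right_regular gT).
Proof.
apply: (iffP (mem_right_regular s)) => -[g sg]; exists g.
  by apply/permP=> h; rewrite rhoE.
by move=> h; rewrite sg rhoE.
Qed.

Lemma card_right_regular : #|right_regular gT| = #|gT|.
Proof.
rewrite -cardsT; apply: card_injm => //; apply/injmP=> g h _ _ /permP/(_ 1).
by rewrite !actpermE /= !mul1g.
Qed.

Lemma rho_Hol g : rho g \in Hol gT.
Proof. exact: (subsetP (normG _) _ (mem_rho g)). Qed.

Lemma morph_Hol s : {morph s : g h / g * h} -> s \in Hol gT.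
Proof.
move=> sM; rewrite inE; apply/subsetP=> _ /imsetP[_ /right_regularP[g ->] ->].
apply/right_regularP; exists (s g); apply/permP=> h.
by rewrite -(permKV s h) permJ !rhoE sM.
Qed.

Lemma inn_Hol g : inn g \in Hol gT.
Proof. by apply: morph_Hol => h k; rewrite !innE conjMg. Qed.

(** If [s] normalizes the right translations, then conjugating translation by
    [h] yields translation by some [h'], so [s (g * h) = s g * h'] for every
    [g]; the value [g = 1] identifies [h'] as [s h]. *)
Lemma Hol_fix1_morph s : s \in Hol gT -> s 1 = 1 -> {morph s : g h / g * h}.
Proof.
move=> Hs s1 g h; have: rho h ^ s \in right_regular gT.
  by rewrite memJ_norm ?mem_rho.
case/right_regularP=> h' def_h'.
have sMr k : s (k * h) = s k * h' by rewrite -(rhoE h') -def_h' permJ rhoE.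
by rewrite sMr -{1}(mul1g h) sMr s1 mul1g.
Qed.

Lemma Hol_decomp u : u \in Hol gT ->
  exists2 s : {perm gT}, {morph s : g h / g * h} & u = s * rho (u 1).
Proof.
move=> Hu; exists (u * (rho (u 1))^-1); last by rewrite mulgKV.
apply: Hol_fix1_morph; first by rewrite groupM ?groupV ?rho_Hol.
by rewrite permM; apply: (@perm_inj _ (rho (u 1))); rewrite permKV rhoE mul1g.
Qed.

Definition class2 := forall g h k, commute [~ g, h] k.

Lemma power_perm d : coprime #|gT| d ->
  exists s : {perm gT}, forall g, s g = g ^+ d.
Proof.
rewrite -cardsT => co_d.
have inj_d : injective (fun g : gT => g ^+ d).
  move=> g h /(congr1 (fun k => k ^+ expg_invn [set: gT] d)).
  by rewrite !expgK ?inE.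
by exists (perm inj_d) => g; rewrite permE.
Qed.

(** With d = 2 m + 1, class two gives
    (h g)^d = h^d g^d [g, h]^(d m) = (h^d)^(g^-m) g^d,
    so the power map conjugates translation by [g] into an inner automorphism
    followed by translation by [g ^+ d].  It commutes with automorphisms. *)
Lemma power_NHol d s : class2 -> odd d -> (forall g, s g = g ^+ d) ->
  s \in NHol gT.
Proof.
move=> cl2 odd_d sE; rewrite inE; apply/subsetP=> _ /imsetP[u Hu ->].
have [a aM ->] := Hol_decomp Hu; rewrite conjMg; apply: groupM.
  suffices ->: a ^ s = a by apply: morph_Hol.
  by apply/permP=> h; rewrite -(permKV s h) permJ !sE morph_permX.
move: (u 1) => g {u Hu a aM}; set m := d./2.
have def_d : d = m.*2.+1 by rewrite -[LHS]odd_double_half odd_d.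
suffices ->: rho g ^ s = inn (g ^- m) * rho (g ^+ d).
  by rewrite groupM ?inn_Hol ?rho_Hol.
apply/permP=> h; rewrite -(permKV s h) permJ permM innE !rhoE !sE.
move: (s^-1 h) => {}h.
rewrite expMg_Rmul; [|exact: commute_sym|exact: commute_sym].
have ->: 'C(d, 2) = (d * m)%N.
  by rewrite bin2 def_d /= mulnC -doubleMl doubleK mulnC.
rewrite conjg_mulR -[LHS]mulgA -[RHS]mulgA; congr (_ * _).
rewrite commgV; last exact: commute_sym.
rewrite invg_comm commXXg; [|exact: commute_sym|exact: commute_sym].
by rewrite mulnC; apply: (commuteX2 _ _ (commute_sym (cl2 g h g))).
Qed.

Section Conjugates.

Variable theta : {perm gT}.
Hypothesis NHtheta : theta \in NHol gT.
Let N : {group {perm gT}} := (right_regular gT :^ theta)%G.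

Lemma conj_regular_sub_Hol : N \subset Hol gT.
Proof. by rewrite -(normP NHtheta) conjSg normG. Qed.

Lemma conj_regularJ u s : u \in Hol gT -> s \in N -> s ^ u \in N.
Proof.
move=> Hu Ns; rewrite memJ_norm // normJ.
by rewrite -(normP NHtheta) in Hu.
Qed.

Lemma conj_regular_inj g : {in N &, forall s t, s g = t g -> s = t}.
Proof.
move=> _ _ /imsetP[_ /right_regularP[h ->] ->]
  /imsetP[_ /right_regularP[k ->] ->].
by rewrite -(permKV theta g) !permJ !rhoE => /perm_inj/mulgI ->.
Qed.

Lemma conj_regular_trans g h : exists2 s, s \in N & s g = h.
Proof.
pose a := theta^-1 g; pose b := theta^-1 h.
exists (rho (a^-1 * b) ^ theta); first by rewrite memJ_conjg mem_rho.
by rewrite -{1}(permKV theta g) permJ rhoE mulKVg permKV.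
Qed.

Lemma abelian_conj_regular : abelian N -> abelian [set: gT].
Proof.
rewrite /N /= abelianJ => /centsP cNN; apply/centsP=> g _ h _.
have := cNN _ (mem_rho g) _ (mem_rho h); move/permP/(_ 1).
by rewrite !permM !rhoE !mul1g.
Qed.

Lemma card_conj_regular : #|N| = #|gT|.
Proof. by rewrite cardJg card_right_regular. Qed.

End Conjugates.

(** NHol acts by conjugation on the conjugates of the right regular
    representation, and the stabilizer of the latter is Hol by definition. *)
Lemma card_T : #|T gT| = #|right_regular gT :^: NHol gT|.
Proof.
rewrite card_quotient ?subxx // card_conjugates; congr #|_ : _|.
exact/esym/setIidPr/normG.
Qed.

End Holomorph.

(** * Right translations twisted by inner automorphisms *)

(** The map [h |-> g ^- k * h * g ^+ k.+1]: right translation for [k = 0], and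
    left translation when [k] is -1 modulo the order of [g]. *)
Definition inn_rho {gT : finGroupType} k (g : gT) : {perm gT} :=
  inn (g ^+ k) * rho g.

Lemma inn_rhoE (gT : finGroupType) k (g h : gT) :
  inn_rho k g h = h ^ (g ^+ k) * g.
Proof. by rewrite permM innE rhoE. Qed.

Lemma inn_rho_conj_morph (gT : finGroupType) (s : {perm gT}) k g :
  {morph s : g h / g * h} -> inn_rho k g ^ s = inn_rho k (s g).
Proof.
move=> sM; apply/permP=> h; rewrite -(permKV s h) permJ !inn_rhoE sM /conjg !sM.
by rewrite (morph_permV sM) !(morph_permX sM).
Qed.

(** As [g ^+ k] and [h ^+ k] commute modulo the centre, both products conjugate
    in the same way and then translate on the right, by [g * h * [~ g, h] ^+ k] and
    by [h * g * [~ g, h] ^- k] respectively. *)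
Lemma inn_rho_commute (gT : finGroupType) k (g h : gT) :
    class2 gT -> [~ g, h] ^+ k.*2.+1 = 1 ->
  inn_rho k g * inn_rho k h = inn_rho k h * inn_rho k g.
Proof.
move=> cl2 c1; have cZ n a : commute ([~ g, h] ^+ n) a.
  exact/commute_sym/commuteX/commute_sym.
apply/permP=> a; rewrite [LHS]permM [RHS]permM !inn_rhoE.
rewrite !(conjMg (_ ^ _)) -!conjgM -[LHS]mulgA -[RHS]mulgA.
have -> : a ^ (g ^+ k * h ^+ k) = a ^ (h ^+ k * g ^+ k).
  rewrite (commgC (g ^+ k)) conjgM commXXg; try exact: commute_sym.
  by rewrite [_ ^ (_ ^+ (k * k))]/conjg -(cZ _ (_ ^ _)) mulKg.
congr (_ * _); rewrite 2!conjg_mulR !commgX; try exact: commute_sym.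
rewrite -(invg_comm g h) expgVn; move: (commgC g h) c1 cZ.
move: [~ g, h] => c ghc c1 cZ; rewrite -mulgA cZ mulgA ghc.
apply: (mulIg (c ^+ k)); rewrite -!mulgA -(cZ k g) mulKg.
by rewrite -expgD -expgS addnn c1 mulg1.
Qed.

(** * Generators and automorphisms of the modular group *)

Lemma odd_prime_gt2 p : prime p -> 2 < p -> odd p.
Proof. by move=> p_pr; case: (even_prime p_pr) => // ->. Qed.

Section ModularGroup.

Variables (p : nat) (gT : finGroupType).
Hypotheses (p_pr : prime p) (p_gt2 : 2 < p).
Hypothesis isoG :
  [set: gT] \isog Grp (x : y : x ^+ (p ^ 2), y ^+ p, [~ x, y] = x ^+ p).

Lemma presentation_generators : exists xy : gT * gT, let: (x, y) := xy in
  [/\ #|gT| = (p ^ 3)%N, #[x] = (p ^ 2)%N & #[y] = p]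
  /\ [/\ [~ x, y] = x ^+ p, class2 gT
       & forall g, exists i j, g = x ^+ i * y ^+ j].
Proof.
have isoM: [set: gT] \isog 'Mod_(p ^ 3).
  have presM := modular_group_pres p_pr p_gt2.
  by rewrite isogEhom presM isoG (isoGrp_hom presM) (isoGrp_hom isoG).
have [[x y] genG modG] := generators_modular_group p_pr (isT : 2 < 3) isoM.
have [[sdG _ _] [defZ _ _] [defG' _ nil2] _ _] :=
  modular_group_structure p_pr (isT : 2 < 3) genG isoM modG.
case: genG modG => oG _ ox _ [oy xy]; exists (x, y).
split; first by rewrite -cardsT.
split.
- by rewrite commgEl xy expn1 expgS mulKg.
- move=> g h k; have: [~ g, h] \in 'Z([set: gT]).
    by rewrite defZ -[p]expn1 -defG' mem_commg ?inE.
  by case/centerP=> _; apply; rewrite inE.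
move=> g; have: g \in <[x]> * <[y]> by rewrite (sdprodW sdG) inE.
by case/imset2P=> _ _ /cycleP[i ->] /cycleP[j ->] ->; exists i, j.
Qed.

(** The subgroup of the square of the group generated by [(x, x')] and
    [(y, y')] satisfies the presentation, hence has at most as many elements as
    the group; since it projects onto each factor, it is the graph of an
    automorphism. *)
Lemma presentation_automorphism (x y x' y' : gT) :
    x ^+ (p ^ 2) = 1 -> y ^+ p = 1 -> [~ x, y] = x ^+ p ->
    x' ^+ (p ^ 2) = 1 -> y' ^+ p = 1 -> [~ x', y'] = x' ^+ p ->
    <[x]> <*> <[y]> = [set: gT] -> <[x']> <*> <[y']> = [set: gT] ->
  exists2 s : {perm gT}, {morph s : g h / g * h} & s x = x' /\ s y = y'.
Proof.
move=> xp yp xy xp' yp' xy' gen gen'.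
pose H := (<[(x, x')]> <*> <[(y, y')]>)%G.
have homH: H \homg [set: gT].
  rewrite isoG; apply/existsP; exists ((x, x'), (y, y')) => /=.
  have eX (a b : gT) n : (a, b) ^+ n = (a ^+ n, b ^+ n).
    by elim: n => // n IHn; rewrite !expgS IHn.
  by rewrite !xpair_eqE !eX xp yp xp' yp' -xy -xy' !eqxx.
have sHx: (x, x') \in H by rewrite mem_gen // inE cycle_id.
have sHy: (y, y') \in H by rewrite mem_gen // inE cycle_id orbT.
have leH: #|H| <= #|gT| by rewrite -cardsT (leq_homg homH).
have onto1: [set u.1 | u in H] = [set: gT].
  apply/eqP; rewrite -subTset -gen -[imset _ _]/(fst_morphism gT gT @: H).
  rewrite -morphimEsub ?subsetT // join_subG !cycle_subG.
  pose inH := mem_morphim (fst_morphism gT gT) (in_setT _).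
  by apply/andP; split; [apply: (inH _ _ sHx) | apply: (inH _ _ sHy)].
have onto2: [set u.2 | u in H] = [set: gT].
  apply/eqP; rewrite -subTset -gen' -[imset _ _]/(snd_morphism gT gT @: H).
  rewrite -morphimEsub ?subsetT // join_subG !cycle_subG.
  pose inH := mem_morphim (snd_morphism gT gT) (in_setT _).
  by apply/andP; split; [apply: (inH _ _ sHx) | apply: (inH _ _ sHy)].
have inj1: {in H &, injective (fst : gT * gT -> gT)}.
  by apply/imset_injP; rewrite eqn_leq leq_imset_card onto1 cardsT.
have inj2: {in H &, injective (snd : gT * gT -> gT)}.
  by apply/imset_injP; rewrite eqn_leq leq_imset_card onto2 cardsT.
have exH g : exists h, (g, h) \in H.
  have /imsetP[[a h] Hah ->]: g \in [set u.1 | u in H] by rewrite onto1 inE.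
  by exists h.
pose f g := xchoose (exH g).
have Hf g : (g, f g) \in H by apply: (xchooseP (exH g)).
have fE g h : (g, h) \in H -> f g = h.
  by move=> Hgh; have [] := inj1 _ _ (Hf g) Hgh (erefl g).
have f_inj : injective f.
  by move=> g h eq_f; have [] := inj2 _ _ (Hf g) (Hf h) eq_f.
exists (perm f_inj); last by rewrite !permE; split; apply: fE.
by move=> g h; rewrite !permE; apply: fE; apply: (groupM (Hf g) (Hf h)).
Qed.

Section Generators.

Variables x y : gT.
Hypotheses (oG : #|gT| = (p ^ 3)%N) (ox : #[x] = (p ^ 2)%N) (oy : #[y] = p).
Hypotheses (xy : [~ x, y] = x ^+ p) (cl2 : class2 gT).
Hypothesis normal_form : forall g, exists i j, g = x ^+ i * y ^+ j.

Lemma expx_eq1 n : (x ^+ n == 1) = (p ^ 2 %| n).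
Proof. by rewrite -order_dvdn ox. Qed.

Lemma exppx_eq1 n : (x ^+ (p * n) == 1) = (p %| n).
Proof. by rewrite expx_eq1 expnS expn1 dvdn_pmul2l ?prime_gt0. Qed.

Lemma expp_central n (g : gT) : commute (x ^+ (p * n)) g.
Proof.
by rewrite expgM -xy; apply/commute_sym/commuteX/commute_sym.
Qed.

Lemma commx_normal_form i j : [~ x, x ^+ i * y ^+ j] = x ^+ (p * j).
Proof.
have /commgP/eqP cxx : commute x (x ^+ i) by exact: commuteX.
rewrite commgMJ cxx conj1g mulg1 commgX ?xy ?expgM // -xy.
exact/commute_sym/cl2.
Qed.

Lemma commute_generator (g : gT) : commute x g -> exists i, g = x ^+ i.
Proof.
have [i [j ->]] := normal_form g => /commgP; rewrite commx_normal_form exppx_eq1.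
rewrite -oy order_dvdn => /eqP ->.
by rewrite mulg1; exists i.
Qed.

Lemma morph_perm_ext (s t : {perm gT}) :
    {morph s : g h / g * h} -> {morph t : g h / g * h} ->
  s x = t x -> s y = t y -> s = t.
Proof.
move=> sM tM sx sy; apply/permP=> g; have [i [j ->]] := normal_form g.
by rewrite sM tM !morph_permX // sx sy.
Qed.

Lemma automorphism_moving_x x' :
    x' ^+ (p ^ 2) = 1 -> [~ x', y] = x' ^+ p -> x \in <[x']> <*> <[y]> ->
  exists2 s : {perm gT}, {morph s : g h / g * h} & s x = x'.
Proof.
move=> xp' xy' gen_x; have yY x1 : y \in <[x1]> <*> <[y]>.
  by rewrite mem_gen // inE cycle_id orbT.
have gen x1 : x \in <[x1]> <*> <[y]> -> <[x1]> <*> <[y]> = [set: gT].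
  move=> x1x; apply/eqP; rewrite -subTset; apply/subsetP=> g _.
  by have [i [j ->]] := normal_form g; rewrite groupM ?groupX ?yY.
have xp : x ^+ (p ^ 2) = 1 by rewrite -ox expg_order.
have yp : y ^+ p = 1 by rewrite -oy expg_order.
have [|s sM [sx _]] :=
    presentation_automorphism xp yp xy xp' yp xy' _ (gen _ gen_x).
  by apply: gen; rewrite mem_gen // inE cycle_id.
by exists s.
Qed.

Lemma automorphism_power n : coprime p n ->
  exists2 s : {perm gT}, {morph s : g h / g * h} & s x = x ^+ n.
Proof.
move=> co_n; apply: automorphism_moving_x.
- by rewrite expgAC -ox expg_order expg1n.
- by rewrite commXg ?xy 1?expgAC //; apply: commuteX.
have /eqP : generator <[x]> (x ^+ n) by rewrite generator_coprime ox coprimeXl.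
by move=> <-; rewrite mem_gen // inE cycle_id.
Qed.

Lemma central_expp (g : gT) :
  (forall h, commute g h) -> exists n, g = x ^+ (p * n).
Proof.
move=> gZ; have [i def_g] := commute_generator (commute_sym (gZ x)).
have := gZ y; rewrite {}def_g => /commgP.
rewrite commXg ?xy; last exact: commuteX.
rewrite -expgM exppx_eq1 => /dvdnP[n ->]; by exists n; rewrite mulnC.
Qed.

(** Commutators are powers of [x ^+ p], hence of order dividing [p], and [p],
    being odd, divides ['C(p, 2)]. *)
Lemma comm_expp_bin (g h : gT) : [~ g, h] ^+ 'C(p, 2) = 1.
Proof.
have /dvdnP[m ->] : p %| 'C(p, 2) by rewrite prime_dvd_bin ?p_gt2.
have [n ->] := central_expp (cl2 g h); apply/eqP.
by rewrite -expgM -mulnA exppx_eq1 mulnA dvdn_mull.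
Qed.

Lemma expgM_p (g h : gT) : (g * h) ^+ p = g ^+ p * h ^+ p.
Proof.
have cZ a b k : commute a [~ b, k] := commute_sym (cl2 b k a).
by rewrite (expMg_Rmul p (cZ h h g) (cZ g h g)) comm_expp_bin mulg1.
Qed.

Lemma automorphism_mul :
  exists2 s : {perm gT}, {morph s : g h / g * h} & s x = x * y.
Proof.
have xyp : (x * y) ^+ p = x ^+ p.
  by rewrite expgM_p -[in y ^+ _]oy expg_order mulg1.
apply: automorphism_moving_x.
- by apply/eqP; rewrite expnS expn1 expgM xyp -expgM exppx_eq1.
- by rewrite commMgJ commgg mulg1 xy xyp -xy conjgE (cl2 x y y) mulKg.
by rewrite -{1}(mulgK y x) groupM ?groupV ?mem_gen // inE cycle_id ?orbT.
Qed.

(** * Conjugates of the right regular representation *)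

Section NormalConjugate.

Variable theta : {perm gT}.
Hypothesis NHtheta : theta \in NHol gT.
Let N : {group {perm gT}} := (right_regular gT :^ theta)%G.

Lemma conj_regular_morphJ (s t : {perm gT}) :
    {morph s : g h / g * h} -> t \in N -> t ^ s \in N /\ (t ^ s) 1 = s (t 1).
Proof.
move=> sM Nt; rewrite -[in _ _ 1](morph_perm1 sM) permJ; split=> //.
exact: conj_regularJ (morph_Hol sM) Nt.
Qed.

(** Conjugation by [x] is an automorphism fixing [x], so it centralizes [t] and
    hence [a]; therefore [a x] and [x] induce the same inner automorphism. *)
Lemma conj_regular_linear_part_x (t a : {perm gT}) :
    t \in N -> t 1 = x -> {morph a : g h / g * h} -> (forall h, t h = a h * x) ->
  exists e, a x = x ^+ (p * e).+1.
Proof.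
move=> Nt t1 aM tE; have inM : {morph inn x : g h / g * h}.
  by move=> g h; rewrite !innE conjMg.
have [Ntx tx1] := conj_regular_morphJ inM Nt.
have t_inn : t ^ inn x = t.
  by apply: (conj_regular_inj Ntx Nt (g := 1)); rewrite tx1 innE t1 conjgE mulKg.
have a_inn g : g ^ a x = g ^ x.
  have := permJ t (inn x) (a^-1 g).
  rewrite t_inn !innE !tE permKV conjMg [x ^ x]conjgE mulKg => /mulIg.
  by rewrite /conjg !aM (morph_permV aM) permKV.
have [|e def_e] := @central_expp (a x * x^-1).
  move=> g; apply/commute_sym/commgP.
  by rewrite commgEl conjgM a_inn conjgK mulVg.
by exists e; rewrite expgSr -def_e mulgKV.
Qed.

(** Let [a x = x ^+ (p * e).+1] and let [b] be the automorphism with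
    [b x = x ^+ (p * e - 1)], the exponent being taken modulo [p ^ 2].  Both
    [t ^ b] and [t^-1] send 1 to [b x], so they agree; comparing them at [b x]
    gives [x ^+ (2 * p * e) = 1]. *)
Lemma conj_regular_linear_part_fix_x (t a : {perm gT}) :
    t \in N -> t 1 = x -> {morph a : g h / g * h} -> (forall h, t h = a h * x) ->
  a x = x.
Proof.
move=> Nt t1 aM tE; have [e ax] := conj_regular_linear_part_x Nt t1 aM tE.
have p_gt0 := prime_gt0 p_pr.
set c := (p * e).+1 in ax; pose s := (p * e + (p ^ 2).-1)%N.
have p2_gt0 : 0 < p ^ 2 by rewrite expn_gt0 p_gt0.
have cs1 : x ^+ (c * s).+1 = 1.
  (* c * s + 1 = (p e + 1) (p e - 1 + p ^ 2) + 1 = p ^ 2 (e ^ 2 + p e + 1) *)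
  apply/eqP; rewrite expx_eq1; apply/dvdnP; exists (e * e + p * e + 1)%N.
  rewrite /c /s; move: p2_gt0; rewrite !expnS expn0 muln1; nia.
have co_s : coprime p s.
  have p_s1 : p %| s + 1.
    by rewrite addn1 -addnS prednK // dvdn_add ?dvdn_mulr // dvdn_exp.
  rewrite prime_coprime //; apply/negP=> p_s; move: p_s1.
  by rewrite dvdn_addr // dvdn1 gtn_eqF // ltnW.
have [b bM bx] := automorphism_power co_s.
have [Ntb tb1] := conj_regular_morphJ bM Nt.
have aX n : a (x ^+ n) = x ^+ (c * n) by rewrite morph_permX // ax expgM.
have tX n : t (x ^+ n) = x ^+ (c * n).+1 by rewrite tE aX -expgSr.
have tx : t x = x ^+ c.+1 by rewrite tE ax -expgSr.
have tb : t ^ b = t^-1.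
  apply: (conj_regular_inj Ntb (groupVr Nt) (g := 1)); rewrite tb1 t1 bx.
  by apply: (@perm_inj _ t); rewrite tX cs1 permKV.
have := permJ t b x; rewrite tb => /(congr1 t).
rewrite permKV bx tx morph_permX // bx -expgM tX => xs.
have: x ^+ (s + c) = 1.
  rewrite expgD xs -expgD -(expg1n _ c.+1) -cs1 -expgM; congr (_ ^+ _).
  by rewrite /c; nia.
move/eqP; rewrite expx_eq1 /s /c -addnA addnS -addSn prednK //.
have -> : (p * e + (p ^ 2 + p * e) = p * (2 * e + p))%N.
  by rewrite expnS expn1; nia.
rewrite expnS expn1 dvdn_pmul2l // dvdn_addl // Euclid_dvdM //.
rewrite gtnNdvd //= -exppx_eq1 => /eqP pe1.
by rewrite ax expgS pe1 mulg1.
Qed.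

(** Once [a] fixes [x], it fixes [x ^+ p = [~ x, y]], so [a y] lies in
    [<[x]> * y]; having order [p], it is [x ^+ (p * m) * y] for some [m], which is
    a conjugate of [y] under a power of [x]. *)
Lemma conj_regular_inn_rho (t : {perm gT}) :
  t \in N -> t 1 = x -> exists k : 'I_p, t = inn_rho k x.
Proof.
move=> Nt t1; have p_gt0 := prime_gt0 p_pr.
have [a aM def_t] := Hol_decomp (subsetP (conj_regular_sub_Hol NHtheta) _ Nt).
have tE h : t h = a h * x by rewrite def_t permM rhoE t1.
have ax := conj_regular_linear_part_fix_x Nt t1 aM tE.
have [i [j ay]] := normal_form (a y).
have yj : y ^+ j = y.
  have: x ^+ (p * j) == x ^+ (p * 1).
    rewrite muln1 -(commx_normal_form i) -ay -{1}ax -morph_permR //.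
    by rewrite xy morph_permX // ax.
  rewrite -[y in RHS]expg1 eq_expg_mod_order ox expnS expn1 -!muln_modr.
  by rewrite eqn_pmul2l // => eq_j1; apply/eqP; rewrite eq_expg_mod_order oy.
have [m def_i] : exists m, i = (p * m)%N.
  have: a y ^+ p = 1 by rewrite -morph_permX // -oy expg_order morph_perm1.
  rewrite ay yj expgM_p -[in y ^+ _]oy expg_order mulg1 -expgM mulnC => /eqP.
  by rewrite exppx_eq1 => /dvdnP[m ->]; exists m; rewrite mulnC.
(* Conjugation by [x ^+ k] multiplies [y] by [x ^- (p * k)], hence k = - m. *)
pose k := (p.-1 * m %% p)%N; have lt_kp : k < p by rewrite ltn_mod.
exists (Ordinal lt_kp) => /=; rewrite def_t t1; congr (_ * _).
apply: morph_perm_ext => //.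
- by move=> g h; rewrite !innE conjMg.
- by rewrite ax innE conjgE commuteX // mulKg.
rewrite ay yj def_i innE conjg_mulR -invg_comm commXg ?xy; last exact: commuteX.
rewrite -expgM; apply: (mulIg (x ^+ (p * k))); rewrite mulgKV.
rewrite -mulgA -(expp_central k y) mulgA -expgD -mulnDr.
have /eqP -> : x ^+ (p * (m + k)) == 1; last by rewrite mul1g.
rewrite exppx_eq1 /dvdn modnDmr -[m in (m + _)%N]mul1n -mulnDl add1n prednK //.
by rewrite modnMr.
Qed.

Lemma not_commute_xy : x * y != y * x.
Proof.
apply/eqP=> cxy; have /commgP : commute x y by [].
by rewrite xy -[p]muln1 exppx_eq1 gtnNdvd // prime_gt1.
Qed.

Lemma conj_regular_not_abelian : ~~ abelian N.
Proof.
apply/negP=> /abelian_conj_regular/centsP cGG.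
by case/eqP: not_commute_xy; apply: cGG; rewrite inE.
Qed.

(** The orbit of 1 under the two generators contains [<[x]>] and [x * y], so it
    has more than [p ^ 2] points and the group that they generate has order
    [p ^ 3].  They would commute if [p] divided [k.*2.+1]. *)
Lemma conj_regular_generators :
  exists2 k : 'I_p, ~~ (p %| k.*2.+1)
    & N :=: <<[set inn_rho k x; inn_rho k (x * y)]>>.
Proof.
have [t Nt t1] := conj_regular_trans theta 1 x.
have [k def_t] := conj_regular_inn_rho Nt t1; rewrite {t}def_t in Nt t1.
have [b bM bx] := automorphism_mul.
have [Nxy _] := conj_regular_morphJ bM Nt.
rewrite inn_rho_conj_morph // bx in Nxy.
pose M := <<[set inn_rho k x; inn_rho k (x * y)]>>; have sMN : M \subset N.
  by rewrite gen_subG; apply/subsetP=> t; rewrite !inE => /orP[] /eqP ->.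
have Mx : inn_rho k x \in M by rewrite mem_gen // !inE eqxx.
have Mxy : inn_rho k (x * y) \in M by rewrite mem_gen // !inE eqxx orbT.
have orbX n : (inn_rho k x ^+ n) 1 = x ^+ n.
  elim: n => [|n IHn]; first by rewrite perm1.
  by rewrite expgSr permM IHn inn_rhoE expgSr conjgE commuteX2 // mulKg.
have xy'x : x * y \notin <[x]>.
  rewrite groupMl ?cycle_id //; apply/cycleP=> -[n def_y].
  by case/eqP: not_commute_xy; rewrite def_y commuteX.
have ltM : p ^ 2 < #|M|.
  have <- : #|x * y |: <[x]>| = (p ^ 2).+1 by rewrite cardsU1 xy'x -ox.
  apply: leq_trans (leq_imset_card (fun t : {perm gT} => t 1) M).
  apply/subset_leq_card/subsetP=> g; rewrite !inE.
  case/orP=> [/eqP -> | /cycleP[n ->]].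
    apply/imsetP; exists (inn_rho k (x * y)) => //.
    by rewrite inn_rhoE conj1g mul1g.
  by apply/imsetP; exists (inn_rho k x ^+ n) => //; rewrite groupX.
have oN : #|N| = (p ^ 3)%N by rewrite card_conj_regular oG.
have defN : N :=: M.
  apply/eqP; rewrite eq_sym eqEcard sMN oN.
  have : #|M| %| p ^ 3 by rewrite -oN cardSg.
  case/(dvdn_pfactor _ _ p_pr) => n le_n3 oM; rewrite oM in ltM *.
  by rewrite leq_exp2l ?ltn_exp2l ?prime_gt1 // in ltM *.
exists k => //; apply: contra conj_regular_not_abelian => p_k.
rewrite defN abelian_gen; apply/centsP.
have cMM : inn_rho k x * inn_rho k (x * y) = inn_rho k (x * y) * inn_rho k x.
  apply: inn_rho_commute => //.
  rewrite -[x in x * _]expg1 -[y in x ^+ 1 * y]expg1.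
  by rewrite commx_normal_form muln1 -expgM; apply/eqP; rewrite exppx_eq1.
by move=> s; rewrite !inE => /orP[] /eqP -> t; rewrite !inE => /orP[] /eqP ->.
Qed.

End NormalConjugate.

(** For [k] below [p] the condition excludes [k = (p - 1) / 2]. *)
Lemma card_T_le : #|T gT| <= p.-1.
Proof.
have p_gt0 := prime_gt0 p_pr; have ltk0 : p.-1./2 < p.
  by rewrite (leq_ltn_trans (half_leq (leqnn _))) //; lia.
pose K := [set k : 'I_p | ~~ (p %| k.*2.+1)].
have le_K : #|K| <= p.-1.
  rewrite -[X in X.-1]card_ord -cardsT.
  rewrite [#|[set: _]|](cardsD1 (Ordinal ltk0)) inE /=.
  apply/subset_leq_card/subsetP=> k; rewrite !inE andbT.
  have odd_p : odd p by apply: odd_prime_gt2.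
  apply: contraNneq => -> /=; rewrite halfK -subn1 oddB // odd_p subn0 subn1.
  by rewrite prednK.
rewrite card_T; apply: leq_trans le_K.
pose gen2 (k : 'I_p) := <<[set inn_rho k x; inn_rho k (x * y)]>>.
apply: leq_trans (leq_imset_card gen2 K).
apply/subset_leq_card/subsetP=> _ /imsetP[theta NHtheta ->].
have [k Kk defN] := conj_regular_generators NHtheta.
by apply/imsetP; exists k; rewrite ?inE.
Qed.

(** * The class of a power map *)

(** The defect of multiplicativity is [[~ y, x] ^+ 'C(D, 2)], and [[~ x, y]] has
    order [p]; so [p] divides [D * (D - 1) / 2]. *)
Lemma morph_expgn_mod D : odd D -> coprime p D ->
  (x * y) ^+ D = x ^+ D * y ^+ D -> D = 1 %[mod p].
Proof.
move=> odd_D co_D; have cZ a b k : commute a [~ b, k] := commute_sym (cl2 b k a).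
rewrite (expMg_Rmul D (cZ y y x) (cZ x y x)) => /(canRL (mulKg _)).
rewrite mulVg -invg_comm xy expgVn -expgM => /(congr1 invg); rewrite invgK invg1.
move/eqP; rewrite exppx_eq1 bin2odd // Gauss_dvdr // => p_D.
apply/eqP; rewrite eqn_mod_dvd ?odd_gt0 // subn1.
rewrite -[D.-1]odd_double_half -subn1 oddB ?odd_gt0 // odd_D add0n -muln2 subn1.
exact: dvdn_mulr.
Qed.

End Generators.

Lemma odd_primitive_root : exists d, [/\ odd d, coprime p d &
  forall m, d ^ m = 1 %[mod p] -> p.-1 %| m].
Proof.
have odd_p : odd p by apply: odd_prime_gt2.
have /cyclicP[u def_u] : cyclic [set: {unit 'F_p}].
  exact: field_unit_group_cyclic.
have ou : #[u] = p.-1.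
  by rewrite orderE -def_u card_finField_unit card_Fp.
(* Adding [p], which is odd, to an even representative makes it odd. *)
pose d0 : nat := FinRing.uval u; pose d := if odd d0 then d0 else (d0 + p)%N.
have dE : (d%:R = FinRing.uval u :> 'F_p)%R.
  have d0E : (d0%:R = FinRing.uval u :> 'F_p)%R by rewrite natr_Zp.
  rewrite /d; case: ifP => // _.
  by rewrite -Fp_nat_mod // modnDr Fp_nat_mod.
exists d; split.
- by rewrite /d; case: ifP => // d0_even; rewrite oddD d0_even odd_p.
- rewrite prime_coprime //; apply/negP=> /eqP p_d.
  have := valP u; rewrite /= -dE -Fp_nat_mod // p_d.
  by rewrite GRing.unitr0.
move=> m dm1; rewrite -ou order_dvdn; apply/eqP/val_inj.
by rewrite FinRing.val_unitX /= -dE -GRing.natrX -Fp_nat_mod // dm1 Fp_nat_mod.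
Qed.

End ModularGroup.

Theorem proposition5p1 (p : nat) (gT : finGroupType) :
  prime p -> 2 < p ->
  [set: gT] \isog Grp (x : y : x ^+ (p ^ 2), y ^+ p, [~ x, y] = x ^+ p) ->
  cyclic (T gT) /\ #|T gT| = p.-1.
Proof.
move=> p_pr p_gt2 isoG.
have [[x y] [[oG ox oy] [xy cl2 nf]]] :=
  presentation_generators p_pr p_gt2 isoG.
have leT := card_T_le p_pr p_gt2 isoG oG ox oy xy cl2 nf.
have [d [odd_d co_d d_prim]] := odd_primitive_root p_pr p_gt2.
have [|s sE] := @power_perm gT d; first by rewrite oG coprimeXl.
have NHs : s \in NHol gT := power_NHol cl2 odd_d sE.
have sXE m g : (s ^+ m) g = g ^+ (d ^ m).
  elim: m => [|m IHm]; first by rewrite perm1.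
  by rewrite expgSr permM sE IHm expnSr expgM.
pose c := coset (Hol gT) s; have Tc : c \in T gT by apply: mem_quotient.
have oc : p.-1 %| #[c].
  apply: d_prim; apply: (morph_expgn_mod p_pr ox xy cl2).
  - by rewrite oddX odd_d orbT.
  - by rewrite coprimeXr.
  (* The power of [s] that lies in Hol fixes 1, so it is an automorphism. *)
  rewrite -!sXE; apply: Hol_fix1_morph; last by rewrite sXE expg1n.
  apply: coset_idr; first by rewrite groupX.
  by rewrite morphX // expg_order.
have leTc : #|T gT| <= #[c] by apply: leq_trans leT (dvdn_leq _ oc).
have defT : T gT :=: <[c]>.
  by apply/eqP; rewrite eq_sym eqEcard cycle_subG Tc.
split; first by rewrite defT cycle_cyclic.
apply/eqP; rewrite eqn_leq leT /= defT -orderE.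
exact: dvdn_leq (order_gt0 c) oc.
Qed.
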